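(* Let $m$ and $n$ be two non-negative integers and let $$f(m):=\left(\frac{2\left(6+\sqrt{36+(m+2)\log 2}\right)}{\log 2}\right)^{2}.$$ If $n$ is odd, then $X^{(m)}(n)$ is nonnegative; if $n$ is even, then $X^{(m)}(n)>0$ for $n\geq f(m)$.
   Context: For a non-negative integer $m$, the integers $X^{(m)}(n)$ ($n\ge 0$) are defined as the coefficients of the $q$-series (formal power series in $q$, or $|q|<1$) $$\sum_{n\geq0}X^{(m)}(n)q^{n}:=\frac{1}{1-q^{2}}\left(\sum_{n=1}^{\infty}\frac{(-1)^{n}q^{n(3n+1)+2mn}}{1-q^{2n}}-\sum_{n=1}^{\infty}\frac{(-1)^{n}q^{\frac{n(n+1)}{2}+mn}}{1-q^{n}}\right).$$ Here $\log$ is the natural logarithm. *)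

(* Defs.v *)
From mathcomp Require Import all_boot all_order all_algebra.
From mathcomp Require Import reals exp.

Set Implicit Arguments.
Unset Strict Implicit.
Unset Printing Implicit Defensive.

Import Order.TTheory GRing.Theory Num.Theory.
Local Open Scope ring_scope.

(* A formal power series in q over the integers is identified with its
   sequence of coefficients; equality of series is meant pointwise. *)
Definition fps := nat -> int.

Definition fps1 : fps := fun n => (n == 0%N)%:R.

(* The monomial c q^e. *)
Definition fps_mono (c : int) (e : nat) : fps := fun n => c *+ (n == e).

Definition fps_sub (F G : fps) : fps := fun n => F n - G n.

Definition fps_mul (F G : fps) : fps :=
  fun n => \sum_(i < n.+1) F i * G (n - i)%N.

(* 1 / (1 - q^k), meaningful for k > 0 only: see fps_geomP. *)
Definition fps_geom (k : nat) : fps := fun n => (k %| n)%:R.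

(* \sum_(k >= 1) F k for a family such that F k has no term of degree < k, so
   that only the indices k <= n contribute to the coefficient of q^n: see
   fps_sumP. *)
Definition fps_sum (F : nat -> fps) : fps :=
  fun n => \sum_(1 <= k < n.+1) F k n.

Definition termA (m k : nat) : fps :=
  fps_mul (fps_mono ((-1) ^+ k) (k * (3 * k + 1) + 2 * m * k)%N)
          (fps_geom (2 * k)%N).

Definition termB (m k : nat) : fps :=
  fps_mul (fps_mono ((-1) ^+ k) ((k * (k + 1)) %/ 2 + m * k)%N)
          (fps_geom k).

Definition Xcoef (m : nat) : fps :=
  fps_mul (fps_geom 2) (fps_sub (fps_sum (termA m)) (fps_sum (termB m))).

Definition fbound (R : realType) (m : nat) : R :=
  (2 * (6 + Num.sqrt (36 + (m%:R + 2) * ln 2)) / ln 2) ^+ 2.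

Lemma fps_monoM (c : int) (e : nat) (G : fps) (n : nat) :
  fps_mul (fps_mono c e) G n = if (e <= n)%N then c * G (n - e)%N else 0.
Proof.
rewrite /fps_mul /fps_mono; case: leqP => [le_en | lt_ne].
  rewrite (bigD1 (Ordinal (le_en : (e < n.+1)%N))) //= eqxx mulr1n.
  rewrite big1 ?addr0 // => i neq_i.
  have /negPf-> : (i : nat) != e by apply: contraNneq neq_i => ie; exact/eqP/val_inj.
  by rewrite mulr0n mul0r.
rewrite big1 // => i _; rewrite ltn_eqF ?mulr0n ?mul0r //.
by apply: leq_ltn_trans lt_ne; rewrite -ltnS.
Qed.

Lemma fps_geomP (k : nat) : (0 < k)%N ->
  fps_mul (fps_sub fps1 (fps_mono 1 k)) (fps_geom k) =1 fps1.
Proof.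
move=> k_gt0 n.
have -> : fps_mul (fps_sub fps1 (fps_mono 1 k)) (fps_geom k) n =
  fps_mul (fps_mono 1 0) (fps_geom k) n - fps_mul (fps_mono 1 k) (fps_geom k) n.
  rewrite /fps_mul -sumrB; apply: eq_bigr => i _.
  by rewrite -mulrBl.
rewrite !fps_monoM leq0n subn0 !mul1r /fps_geom /fps1.
case: leqP => [le_kn | lt_nk].
  by rewrite dvdn_subl // subrr gtn_eqF // (leq_trans k_gt0).
rewrite subr0; case: n lt_nk => [|n] lt_nk; first by rewrite dvdn0.
by rewrite gtnNdvd.
Qed.

Lemma fps_sumP (F : nat -> fps) :
    (forall k n, (n < k)%N -> F k n = 0) ->
  forall n N, (n < N)%N -> \sum_(1 <= k < N) F k n = fps_sum F n.
Proof.
move=> F0 n N lt_nN; rewrite /fps_sum (big_cat_nat _ lt_nN) //=.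
by rewrite [X in _ + X]big_nat [X in _ + X]big1 ?addr0 // => k /andP[/F0].
Qed.

Lemma termA_low (m k n : nat) : (n < k)%N -> termA m k n = 0.
Proof.
move=> lt_nk; rewrite /termA fps_monoM leqNgt (leq_trans lt_nk) //.
apply: leq_trans (leq_addr _ _).
by rewrite addn1 leq_pmulr.
Qed.

Lemma termB_low (m k n : nat) : (n < k)%N -> termB m k n = 0.
Proof.
move=> lt_nk; rewrite /termB fps_monoM leqNgt (leq_trans lt_nk) //.
apply: leq_trans (leq_addr _ _); rewrite leq_divRL // leq_mul2l.
by rewrite addn1 ltnS orbC (leq_ltn_trans (leq0n n)).
Qed.

Lemma fps_sum_termA (m n N : nat) : (n < N)%N ->
  \sum_(1 <= k < N) termA m k n = fps_sum (termA m) n.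
Proof. by move=> lt_nN; apply: fps_sumP lt_nN; apply: termA_low. Qed.

Lemma fps_sum_termB (m n N : nat) : (n < N)%N ->
  \sum_(1 <= k < N) termB m k n = fps_sum (termB m) n.
Proof. by move=> lt_nN; apply: fps_sumP lt_nN; apply: termB_low. Qed.

(* Main.v *)
Require Import Defs.
From mathcomp Require Import all_boot all_order all_algebra.
From mathcomp Require Import reals exp.
From mathcomp Require Import zify ring lra.

Import Order.TTheory GRing.Theory Num.Theory.
Local Open Scope ring_scope.

(** The coefficients of X turn into counts of points of arithmetic progressions,
    and the sign of X(n) is read off by comparing a few of these counts at a time.

    Expanding 1/(1 - q^k) as a geometric series, the k-th term of the second sum
    contributes (-1)^k b_k to the coefficient of q^n, where b_k is the number of
    M >= m with k(k+1)/2 + k M <= n and k(k+1)/2 + k M = n mod 2; the parity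
    condition and the bound come from the factor 1/(1 - q^2). The first sum
    likewise contributes (-1)^k a_k, where a_k counts the M >= m with
    k(3k+1) + 2 k M <= n, of the same parity as n. So
      X(n) = sum_k (-1)^k a_k - sum_k (-1)^k b_k.
    Write d = 2j+1 and J = j+1. As j varies, d runs over the odd k, 2d and 4J
    together run over the even k, and the alternating sums regroup as
      X(n) = sum_j (b_d - a_d) - (b_{2d} + b_{4J} - a_{2J}).
    Every bracket turns out to be nonnegative.

    For n odd, a_k and b_{4J} vanish by parity, and M |-> 2M + (3d+1)/2 injects
    the points counted by b_{2d} into those counted by b_d: both index the same
    integers d(2d + 1 + 2M).

    For n = 2N, b_{2d} vanishes by parity. In the variables P = (M + J)/2,
    P = M + 3j + 2, Q = M + 2J, Q = M + 3J for b_d, a_d, b_{4J}, a_{2J}, the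
    conditions become d P <= N in the first two cases and J(2Q + 1) <= N in the
    last two, so that
      b_d - a_d       counts P with (m + J)/2 <= P <= m + 3j + 1, d P <= N,
      b_{4J} - a_{2J} counts Q with m + 2J <= Q <= m + 3J - 1, J(2Q + 1) <= N.
    The second interval is the subinterval [m + 2j + 2, m + 3j + 1] of the first
    with m + 3j + 2 added at its end, and J(2Q + 1) <= N implies d Q <= N. The
    extra Q, when it occurs, is paid for by P = m + 2j + 1, which lies below the
    second interval. Hence the bracket is nonnegative, and for j = 1 there
    are at most two Q against at least three P once 2N >= 3m + 21, so that the
    bracket is positive. As ln 2 <= 1, the threshold f(m) is at least
    4m + 296, which is more than enough. *)

(** * Counting points of arithmetic progressions *)

Definition hit (n e k : nat) : pred nat :=
  fun r => ((e + k * r <= n) && ~~ odd (n - (e + k * r)))%N.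

Definition hits (n e k : nat) : nat := count (hit n e k) (iota 0 n.+1).

Lemma leq_count_inj (f : nat -> nat) (p q : pred nat) (S T : nat) :
    injective f -> (forall r, (r < S)%N -> p r -> q (f r) && (f r < T)%N) ->
  (count p (iota 0 S) <= count q (iota 0 T))%N.
Proof.
move=> f_inj pq; rewrite -!size_filter -(size_map f); apply: uniq_leq_size.
  by rewrite map_inj_uniq // filter_uniq // iota_uniq.
move=> _ /mapP[r + ->]; rewrite !mem_filter !mem_iota !add0n /=.
by case/andP=> pr /(pq r)/(_ pr) /andP[-> ->].
Qed.

Lemma hits_le (n e k b : nat) :
  (forall r, hit n e k r -> (r < b)%N) -> (hits n e k <= b)%N.
Proof.
move=> hb; rewrite -[leqRHS](size_iota 0) -count_predT.
by apply: (leq_count_inj id) => // r _ /hb.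
Qed.

(** The range of [r] in [hits] can be ignored: since [k > 0], a hit is at most
    [n], so any injection into the hits bounds their number from below. *)
Lemma hits_inj (f : nat -> nat) (p : pred nat) (S n e k : nat) :
    (0 < k)%N -> injective f ->
    (forall r, (r < S)%N -> p r -> hit n e k (f r)) ->
  (count p (iota 0 S) <= hits n e k)%N.
Proof.
move=> k_gt0 f_inj ph; apply: (leq_count_inj f) => // r rS /(ph r rS) hf.
rewrite hf ltnS; case/andP: hf => + _; apply: leq_trans.
by rewrite -[leqLHS]mul1n (leq_trans (leq_mul k_gt0 (leqnn _))) ?leq_addl.
Qed.

Lemma hits_ge (f : nat -> nat) (n e k b : nat) :
    (0 < k)%N -> injective f -> (forall r, (r < b)%N -> hit n e k (f r)) ->
  (b <= hits n e k)%N.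
Proof.
move=> k_gt0 f_inj hb; rewrite -[leqLHS](size_iota 0) -count_predT.
by apply: (hits_inj f) => // r rb _; apply: hb.
Qed.

Lemma hits_eq0 (n e k : nat) : (forall r, ~~ hit n e k r) -> hits n e k = 0%N.
Proof.
move=> nh; apply/eqP; rewrite -leqn0; apply: hits_le => r /[!negbTE (nh r)] //.
Qed.

Lemma fps_mono_geom (c : int) (e k x T : nat) : (0 < k)%N -> (x < T)%N ->
  fps_mul (fps_mono c e) (fps_geom k) x =
    c * \sum_(r < T) (x == e + k * r)%N%:R.
Proof.
move=> k_gt0 xT; rewrite fps_monoM /fps_geom; case: leqP => [ex|xe]; last first.
  rewrite big1 ?mulr0 // => r _.
  by have /negPf-> : x != (e + k * r)%N by apply/eqP; nia.
congr (_ * _); case: (boolP (k %| x - e)%N) => [/dvdnP[r xr]|nd].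
  have rT : (r < T)%N by nia.
  rewrite (bigD1 (Ordinal rT)) //=.
  have -> : (x == e + k * r)%N by apply/eqP; nia.
  rewrite big1 ?addr0 // => i /eqP ir.
  have /negPf-> // : x != (e + k * i)%N.
  apply/eqP => xi; apply: ir; apply: val_inj => /=; nia.
rewrite big1 // => r _.
have /negPf-> // : x != (e + k * r)%N.
by apply: contraNneq nd => ->; rewrite addKn dvdn_mulr.
Qed.

(** The bridge from series to counting: multiplying by 1/(1 - q^2) sums the
    coefficients of q^x over the x <= n of the same parity as n. *)
Lemma coef_hits (c : int) (e k n : nat) : (0 < k)%N ->
  fps_mul (fps_geom 2) (fps_mul (fps_mono c e) (fps_geom k)) n =
    c * (hits n e k)%:R.
Proof.
move=> k_gt0.
transitivity (\sum_(i < n.+1) \sum_(r < n.+1)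
    c * ((2 %| i)%N && (n - i == e + k * r)%N)%:R).
  apply: eq_bigr => i _; rewrite (@fps_mono_geom _ _ _ _ n.+1) ?ltnS ?leq_subr //.
  rewrite mulrCA !big_distrr /=; apply: eq_bigr => r _.
  by rewrite /fps_geom -mulnb natrM.
rewrite exchange_big /hits -sum1_count natr_sum big_distrr [RHS]big_mkcond.
rewrite -[X in iota 0 X](subn0 n.+1) -/(index_iota 0 n.+1) big_mkord /=.
apply: eq_bigr => r _; rewrite /hit; case: ifP => [/andP[len evn]|nh].
  have iP : (n - (e + k * r) < n.+1)%N by rewrite ltnS leq_subr.
  rewrite (bigD1 (Ordinal iP)) //= dvdn2 evn subKn // eqxx big1 ?addr0 // => i.
  move=> /eqP ni; case: eqP => [ei|]; last by rewrite andbF mulr0.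
  by case: ni; apply: val_inj => /=; have := ltn_ord i; lia.
rewrite big1 // => i _; case: eqP => [ei|]; last by rewrite andbF mulr0.
rewrite andbT dvdn2; case: (boolP (odd i)) => [_|ev]; first by rewrite mulr0.
have i_le := ltn_ord i; have ni : (n - (e + k * r))%N = i by lia.
by move: nh; rewrite ni ev andbT; lia.
Qed.

(** * The coefficients of X as alternating sums of counts *)

Definition hitsA (m n k : nat) : nat :=
  hits n (k * (3 * k + 1) + 2 * m * k) (2 * k).

Definition hitsB (m n k : nat) : nat :=
  hits n ((k * (k + 1)) %/ 2 + m * k) k.

Lemma Xcoef_hits (m n K L : nat) : (n < K)%N -> (n < L)%N ->
  Xcoef m n = \sum_(1 <= k < K) (-1) ^+ k * (hitsA m n k)%:R
            - \sum_(1 <= k < L) (-1) ^+ k * (hitsB m n k)%:R.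
Proof.
move=> nK nL.
transitivity
  (\sum_(i < n.+1) (\sum_(1 <= k < K) fps_geom 2 i * termA m k (n - i)%N
                  - \sum_(1 <= k < L) fps_geom 2 i * termB m k (n - i)%N)).
  apply: eq_bigr => i _; rewrite -!big_distrr -mulrBr /=; congr (_ * _).
  have ni := leq_subr i n.
  by rewrite (fps_sum_termA m (leq_ltn_trans ni nK))
             (fps_sum_termB m (leq_ltn_trans ni nL)).
rewrite sumrB; congr (_ - _); rewrite exchange_big /=;
  rewrite big_nat_cond [RHS]big_nat_cond; apply: eq_bigr => k /andP[/andP[k1 _] _].
  by rewrite -coef_hits // muln_gt0.
by rewrite -coef_hits.
Qed.

Lemma alternating_sum_pairs (F : nat -> int) (K : nat) :
  \sum_(1 <= k < K.*2.+1) (-1) ^+ k * F k =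
    \sum_(j < K) (F j.*2.+2 - F j.*2.+1).
Proof.
elim: K => [|K IH]; first by rewrite big_ord0 big_geq.
rewrite doubleS 2?big_nat_recr //= IH big_ord_recr /= -addrA; congr (_ + _).
rewrite -(signr_odd _ K.*2.+1) -(signr_odd _ K.*2.+2).
by rewrite /= odd_double /= expr1 mulN1r expr0 mul1r addrC.
Qed.

Lemma sum_even_pairs (F : nat -> int) (K : nat) :
  \sum_(j < K.*2) F j = \sum_(j < K) (F j.*2 + F j.*2.+1).
Proof.
elim: K => [|K IH]; first by rewrite !big_ord0.
by rewrite doubleS !big_ord_recr /= IH addrA.
Qed.

(** The part of the coefficient indexed by j in the regrouping by the odd number
    2j+1: the numbers 2(2j+1) and 4(j+1), for all j, are the even numbers. *)
Definition bracket (m n j : nat) : int :=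
  (hitsB m n j.*2.+1 + hitsA m n j.*2.+2)%:R
  - (hitsA m n j.*2.+1 + hitsB m n j.*2.+1.*2 + hitsB m n j.+1.*2.*2)%:R.

(** To have as many even indices as odd ones after the regrouping, the sum of the
    [hitsB] has to be cut at 4K and that of the [hitsA] at 2K. The terms of the
    former with odd index above 2K are in no bracket; they are nonnegative, hence
    an inequality. *)
Lemma Xcoef_ge (m n K : nat) : (n < K.*2.+1)%N ->
  \sum_(j < K) bracket m n j <= Xcoef m n.
Proof.
move=> nK; rewrite (@Xcoef_hits _ _ K.*2.+1 K.*2.*2.+1) //; last by lia.
rewrite (alternating_sum_pairs (fun k => (hitsA m n k)%:R)).
rewrite (alternating_sum_pairs (fun k => (hitsB m n k)%:R)).
rewrite [X in _ <= _ - X]sumrB opprB addrA addrAC.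
rewrite (sum_even_pairs (fun j => (hitsB m n j.*2.+2)%:R)).
rewrite -[X in \sum_(j < X) (hitsB _ _ j.*2.+1)%:R]addnn big_split_ord /=.
rewrite addrA ler_wpDr ?sumr_ge0 // -sumrB -big_split ler_sum //= => j _.
by rewrite /bracket !natrD le_eqVlt; apply/orP; left; apply/eqP; ring.
Qed.

Lemma half_mul_succ_even (a : nat) :
  ((a.*2 * (a.*2 + 1)) %/ 2 = a * (2 * a + 1))%N.
Proof. by rewrite (_ : (_ * _)%N = (a * (2 * a + 1) * 2)%N) ?mulnK //; nia. Qed.

Lemma half_mul_succ_odd (a : nat) :
  ((a.*2.+1 * (a.*2.+1 + 1)) %/ 2 = a.*2.+1 * a.+1)%N.
Proof. by rewrite (_ : (_ * _)%N = (a.*2.+1 * a.+1 * 2)%N) ?mulnK //; nia. Qed.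

(** * Odd exponents *)

Lemma hitsA_odd (m n k : nat) : odd n -> hitsA m n k = 0%N.
Proof.
move=> n_odd; apply: hits_eq0 => r; apply/negP => /andP[ern].
by rewrite oddB // n_odd !(oddD, oddM) /=; case: odd.
Qed.

Lemma hitsB_4odd (m n j : nat) : odd n -> hitsB m n j.*2.*2 = 0%N.
Proof.
move=> n_odd; apply: hits_eq0 => r; apply/negP => /andP[].
rewrite half_mul_succ_even => ern.
by rewrite oddB // n_odd !(oddD, oddM, odd_double) /= andbF.
Qed.

(** With d = 2j+1, the shift M of the progression with step 2d goes to
    2M + (3d+1)/2 = 2M + 3j + 2 in that with step d, and
    d(2d+1) + 2dM = d(d+1)/2 + d(2M + (3d+1)/2); here M = m + r. *)
Lemma leq_hitsB_double (m n j : nat) : 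
  (hitsB m n j.*2.+1.*2 <= hitsB m n j.*2.+1)%N.
Proof.
apply: (hits_inj (fun r => 2 * r + (m + 3 * j + 2))%N) => //; first by move=> r s; lia.
move=> r _; rewrite /hit half_mul_succ_even half_mul_succ_odd.
suff -> : (j.*2.+1 * (2 * j.*2.+1 + 1) + m * j.*2.+1.*2 + j.*2.+1.*2 * r =
  j.*2.+1 * j.+1 + m * j.*2.+1 + j.*2.+1 * (2 * r + (m + 3 * j + 2)))%N by [].
by nia.
Qed.

Lemma bracket_odd_ge0 (m n j : nat) : odd n -> 0 <= bracket m n j.
Proof.
move=> n_odd; rewrite /bracket !hitsA_odd // hitsB_4odd // addn0 add0n addn0.
by rewrite subr_ge0 ler_nat leq_hitsB_double.
Qed.

(** * Even exponents *)

(** Exclusive bounds for the P with (2j+1) P <= N, and for the Q with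
    (j+1)(2Q+1) <= N. *)
Definition topP (N j : nat) : nat := (N %/ j.*2.+1).+1.
Definition topQ (N j : nat) : nat := (N %/ j.+1).+1./2.

(** The four counts, in terms of the variables P and Q, are lengths of intervals
    ending at [topP] or [topQ]; each is bounded on the side that is used. *)
Lemma hitsA_odd_le (m N j : nat) :
  (hitsA m N.*2 j.*2.+1 <= topP N j - (m + 3 * j + 2))%N.
Proof.
apply: hits_le => r /andP[le_n _].
have : ((r + (m + 3 * j + 2)) * j.*2.+1 <= N)%N by nia.
by rewrite -leq_divRL // /topP; lia.
Qed.

(** The parity condition makes every other shift r a hit; writing
    m + r + j + 1 = 2P, the least P is (m+j+2)./2, the upper half of m+j+1. *)
Lemma hitsB_odd_ge (m N j : nat) :
  (topP N j - (m + j + 2)./2 <= hitsB m N.*2 j.*2.+1)%N.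
Proof.
apply: (hits_ge (fun r => 2 * r + odd (m + j + 1))%N) => //; first by move=> r s; lia.
move=> r; rewrite /topP => rV.
have : (r + (m + j + 2)./2 <= N %/ j.*2.+1)%N by lia.
rewrite leq_divRL // /hit half_mul_succ_odd => leN.
have cE : (m + j + 1 + odd (m + j + 1) = 2 * (m + j + 2)./2)%N by lia.
have -> : (j.*2.+1 * j.+1 + m * j.*2.+1 + j.*2.+1 * (2 * r + odd (m + j + 1))
  = ((r + (m + j + 2)./2) * j.*2.+1).*2)%N.
  move: cE; move: (m + j + 2)./2 (nat_of_bool _) => c o cE.
  rewrite (_ : _ + _ = j.*2.+1 * (m + j + 1 + o + 2 * r))%N; last by clear cE leN rV; nia.
  by rewrite cE; clear; nia.
by rewrite leq_double leN -doubleB odd_double.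
Qed.

Lemma hitsB_4_le (m N j : nat) :
  (hitsB m N.*2 j.+1.*2.*2 <= topQ N j - (m + 2 * j.+1))%N.
Proof.
apply: hits_le => r /andP[+ _]; rewrite half_mul_succ_even => le_n.
have : ((2 * (r + (m + 2 * j.+1)) + 1) * j.+1 <= N)%N by nia.
by rewrite -leq_divRL // /topQ; lia.
Qed.

Lemma hitsA_even_ge (m N j : nat) :
  (topQ N j - (m + 3 * j.+1) <= hitsA m N.*2 j.+1.*2)%N.
Proof.
apply: (hits_ge id) => // r; rewrite /topQ => rU.
have : (2 * (r + (m + 3 * j.+1)) + 1 <= N %/ j.+1)%N by lia.
rewrite leq_divRL // /hit => leN.
have -> : (j.+1.*2 * (3 * j.+1.*2 + 1) + 2 * m * j.+1.*2 + 2 * j.+1.*2 * r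
  = ((2 * (r + (m + 3 * j.+1)) + 1) * j.+1).*2)%N by nia.
by rewrite leq_double leN -doubleB odd_double.
Qed.

(** Because (2j+1) Q <= (j+1)(2Q+1). *)
Lemma topQ_le_topP (N j : nat) : (topQ N j <= topP N j)%N.
Proof.
have := leq_trunc_div N j.+1; rewrite /topP /topQ; move: (N %/ j.+1)%N => q qN.
suff : (q.+1./2.-1 <= N %/ j.*2.+1)%N by lia.
rewrite leq_divRL //; nia.
Qed.

Lemma hitsB_2odd (m N j : nat) : hitsB m N.*2 j.*2.+1.*2 = 0%N.
Proof.
apply: hits_eq0 => r; apply/negP => /andP[]; rewrite half_mul_succ_even => ern.
by rewrite oddB // !(oddD, oddM, odd_double) /= odd_double andbF.
Qed.

(** The excess of b_{4J} over a_{2J} is the length of [m+2J, m+3J) cut at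
    [topQ], that of b_d over a_d the length of [(m+j+2)./2, m+3j+2) cut at the
    larger [topP]. The latter interval ends one step earlier but starts at least
    one step earlier too. *)
Lemma bracket_even_ge0 (m N j : nat) : 0 <= bracket m N.*2 j.
Proof.
rewrite /bracket subr_ge0 ler_nat hitsB_2odd addn0.
have := hitsA_odd_le m N j; have := hitsB_odd_ge m N j.
have := hitsB_4_le m N j; have := hitsA_even_ge m N j; have := topQ_le_topP N j.
rewrite -doubleS; lia.
Qed.

(** Here d = 3: at most two values Q = m+4, m+5 compete with the values of P from
    (m+3)./2 on, of which three satisfy 3P <= N as soon as 3m + 21 <= 2N. *)
Lemma bracket_even_gt0 (m N : nat) :
  (3 * m + 21 <= N.*2)%N -> 0 < bracket m N.*2 1.
Proof.
move=> mN; rewrite /bracket subr_gt0 ltr_nat hitsB_2odd addn0.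
have := hitsA_odd_le m N 1; have := hitsB_odd_ge m N 1.
have := hitsB_4_le m N 1; have := hitsA_even_ge m N 1; have := topQ_le_topP N 1.
rewrite -doubleS /topP /topQ; lia.
Qed.

(** * The threshold *)

(** With t = 1 / ln 2 >= 1, f(m) = 4 (6+s)^2 t^2 where s >= 0 and
    s^2 t^2 = 36 t^2 + (m+2) t; expanding the square and using t >= 1 gives the
    bound. *)
Lemma fbound_linear (R : realType) (m n : nat) :
  fbound R m <= n%:R -> (4 * m + 296 <= n)%N.
Proof.
have L_gt0 : 0 < ln 2 :> R by rewrite ln_gt0 // ltr1n.
have L_le1 : ln 2 <= 1 :> R.
  by have := @le_ln1Dx R 1; rewrite -[1 + 1]/2 => -> //; lra.
rewrite /fbound -(ler_nat R) => /(le_trans _); apply; rewrite natrD natrM.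
move: (ln 2) L_gt0 L_le1 => L L_gt0 L_le1.
have mL : 0 <= (m%:R + 2) * L by rewrite mulr_ge0 ?addr_ge0 ?ler0n // ltW.
have a_ge0 : 0 <= 36 + (m%:R + 2) * L by lra.
have s2 := sqr_sqrtr a_ge0.
have := sqrtr_ge0 (36 + (m%:R + 2) * L); move: (Num.sqrt _) s2 => s s2 s_ge0.
have t_ge1 : 1 <= L^-1 by rewrite invf_ge1.
have Lt : L * L^-1 = 1 by rewrite divff // gt_eqF.
have m_ge0 : 0 <= m%:R :> R by rewrite ler0n.
move: L^-1 t_ge1 Lt => t t_ge1 Lt.
have -> : (2 * (6 + s) * t) ^+ 2
  = 4 * (36 * t ^+ 2 + 12 * s * t ^+ 2 + s ^+ 2 * t ^+ 2) by ring.
rewrite s2 (_ : (36 + (m%:R + 2) * L) * t ^+ 2 = 36 * t ^+ 2 + (m%:R + 2) * (L * t) * t); last by ring.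
rewrite Lt; have t2 : 1 <= t ^+ 2 by rewrite exprn_ege1.
have : 0 <= s * t ^+ 2 by rewrite mulr_ge0 // sqr_ge0.
have : m%:R + 2 <= (m%:R + 2) * t by rewrite ler_peMr // addr_ge0.
lra.
Qed.

Theorem theorem1p1 (R : realType) (m n : nat) :
  (odd n -> 0 <= Xcoef m n) /\
  (~~ odd n -> fbound R m <= n%:R -> 0 < Xcoef m n).
Proof.
have nn : (n < n.+2.*2.+1)%N by lia.
split=> [n_odd | n_even /fbound_linear n_ge].
  apply: le_trans (Xcoef_ge m n _ nn).
  by apply: sumr_ge0 => j _; apply: bracket_odd_ge0.
apply: lt_le_trans (Xcoef_ge m n _ nn).
move: n_ge; rewrite -(even_halfK n_even) => n_ge.
(* The bracket j = 1 is the one that is positive. *)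
rewrite (bigD1 (lift ord0 ord0)) //= ltr_pwDl ?sumr_ge0 // => [|j _].
  by apply: bracket_even_gt0; lia.
exact: bracket_even_ge0.
Qed.
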